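(* Suppose the control system $F(x,\dot x)=0$ is differentially flat, and let $\varphi:(\mathbb{R}^m)^{r+1}\to\mathbb{R}^n$ be a parameter function associated to the flat system (that is, a parameter function $\varphi$ for which a function $\psi$ as in the definition of differential flatness exists). Then the smooth map $$\Phi:(y_0,\dots,y_{r+1})\mapsto\bigl(\varphi(y_0,\dots,y_r),\ \mathcal{L}_\tau\varphi(y_0,\dots,y_{r+1})\bigr),\qquad (y_0,\dots,y_{r+1})\in(\mathbb{R}^m)^{r+2},$$ is a (surjective) submersion onto the manifold $\{(x,p)\in\mathbb{R}^n\times\mathbb{R}^n : F(x,p)=0\}$; that is, $\Phi$ maps onto this manifold and its differential $d\Phi$ is surjective onto the tangent spaces of this manifold.
   Context: Setting. Let $n>m>0$ be integers and let $F:\mathbb{R}^n\times\mathbb{R}^n\to\mathbb{R}^{n-m}$, $(x,p)\mapsto F(x,p)$, be a smooth function with $\operatorname{rank}\frac{\partial F}{\partial p}=n-m$. The control system is the implicit equation $F(x,\dot x)=0$. It is assumed that for each $x$ there is at least one $p$ with $F(x,p)=0$, and more generally that the manifold $F(x,p)=0$ is parameterized by a smooth function $f:\mathbb{R}^n\times\mathbb{R}^m\to\mathbb{R}^n$ with $F(x,f(x,u))=0$, such that for each fixed $x$ the map $u\mapsto f(x,u)$ is a diffeomorphism onto $\{p:F(x,p)=0\}$. A solution of the system is a smooth function $x(t)$ on an open interval with values in $\mathbb{R}^n$ such that $F(x(t),\dot x(t))=0$ for all $t$. Parameter function. A smooth function $\varphi(y_0,\dots,y_r)$ on $(\mathbb{R}^m)^{r+1}$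 with values in $\mathbb{R}^n$ is a parameter function for the system if for every smooth $y:\mathbb{R}\to\mathbb{R}^m$, the function $x(t)=\varphi(y(t),\dot y(t),\dots,y^{(r)}(t))$ satisfies $F(x(t),\frac{d}{dt}x(t))=0$ for all $t$. Equivalently, for all $y_0,\dots,y_{r+1}\in\mathbb{R}^m$, $F(\varphi(y_0,\dots,y_r),\mathcal{L}_\tau\varphi(y_0,\dots,y_{r+1}))=0$, where $\mathcal{L}_\tau\varphi(y_0,\dots,y_{r+1})=\sum_{i=0}^r\frac{\partial\varphi}{\partial y_i}(y_0,\dots,y_r)\,y_{i+1}$. Differential flatness. The system $F(x,\dot x)=0$ is differentially flat if there exist a parameter function $\varphi(y_0,\dots,y_r)$ and a smooth function $\psi(x_0,\dots,x_s)$ with values in $\mathbb{R}^m$ (where $x_0,\dots,x_s\in\mathbb{R}^n$) such that, for every solution $x(t)$ of the system and every smooth $\mathbb{R}^m$-valued function $y(t)$ on the same open interval, $x=\varphi(y,\dot y,\dots,y^{(r)})$ if and only if $y=\psi(x,\dot x,\dots,x^{(s)})$. Such a $\varphi$ is said to be associated to the flat system. *)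

(* Defs.v *)
From HB Require Import structures.
From mathcomp Require Export all_boot all_order all_algebra.
From mathcomp Require Export all_classical all_reals all_analysis.

Set Implicit Arguments.
Unset Strict Implicit.
Unset Printing Implicit Defensive.
Import Order.TTheory GRing.Theory Num.Theory.
Import numFieldNormedType.Exports.
Local Open Scope ring_scope.
Local Open Scope classical_set_scope.

(* Class C^k on a set D, to be used with D open. In finite dimension, f is
   C^(k+1) iff it is Frechet differentiable and every directional derivative
   of f is C^k. The values of f outside D are irrelevant when D is open. *)
Fixpoint Ck_on (R : realType) (V W : normedModType R) (k : nat)
    (D : set V) (f : V -> W) : Prop :=
  match k with
  | 0 => forall x, D x -> {for x, continuous f}
  | k'.+1 => (forall x, D x -> differentiable f x) /\
             (forall v, Ck_on k' D ('D_v f))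
  end.

Definition smooth_on (R : realType) (V W : normedModType R)
    (D : set V) (f : V -> W) : Prop := forall k, Ck_on k D f.

Definition smooth (R : realType) (V W : normedModType R) (f : V -> W) : Prop :=
  smooth_on setT f.

(* Smoothness of a map on an arbitrary subset A of an ambient space: near each
   point of A, the map is the restriction of a smooth map on an open set. *)
Definition smooth_on_subset (R : realType) (V W : normedModType R)
    (A : set V) (h : V -> W) : Prop :=
  forall q, A q -> exists U : set V, exists g : V -> W,
    [/\ open U, U q, smooth_on U g & forall p, A p -> U p -> g p = h p].

Definition diffeo_onto (R : realType) (V W : normedModType R)
    (A : set W) (f : V -> W) : Prop :=
  [/\ smooth f, range f = A &
      exists h : W -> V, cancel f h /\ smooth_on_subset A h].

Definition tangent_space (R : realType) (V : normedModType R)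
    (M : set V) (q : V) : set V :=
  [set v | exists e : R, exists c : R -> V,
    [/\ 0 < e, smooth_on [set` `]- e, e[] c, (forall t, t \in `]- e, e[ -> M (c t)),
        c 0 = q & derive1 c 0 = v]].

(* For M an embedded submanifold: f maps onto M, and at each point its
   differential maps onto the tangent space of M. *)
Definition surjective_submersion_onto (R : realType) (V W : normedModType R)
    (M : set W) (f : V -> W) : Prop :=
  [/\ smooth f, range f = M &
      forall y : V, range ('d f y) = tangent_space M (f y)].

(* (R^d)^k is 'M[R]_(k, d): row i is the i-th vector. *)
Definition jet (R : realType) (d r : nat) (c : R -> 'rV[R]_d) (t : R) :
    'M[R]_(r.+1, d) :=
  \matrix_(i < r.+1) derive1n i c t.

Section ControlSystem.
Variables (R : realType) (m n : nat).

Definition system_zero_set (F : 'rV[R]_n * 'rV[R]_n -> 'rV[R]_(n - m)) :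
    set ('rV[R]_n * 'rV[R]_n) :=
  [set xp | F xp = 0].

Definition is_solution (F : 'rV[R]_n * 'rV[R]_n -> 'rV[R]_(n - m))
    (I : set R) (x : R -> 'rV[R]_n) : Prop :=
  [/\ open I, is_interval I, smooth_on I x &
      forall t, I t -> F (x t, derive1 x t) = 0].

Definition parameter_function (F : 'rV[R]_n * 'rV[R]_n -> 'rV[R]_(n - m))
    (r : nat) (phi : 'M[R]_(r.+1, m) -> 'rV[R]_n) : Prop :=
  smooth phi /\
  forall y : R -> 'rV[R]_m, smooth y ->
    let x := fun t => phi (jet r y t) in
    forall t, F (x t, derive1 x t) = 0.

Definition associated_to_flat (F : 'rV[R]_n * 'rV[R]_n -> 'rV[R]_(n - m))
    (r : nat) (phi : 'M[R]_(r.+1, m) -> 'rV[R]_n) : Prop :=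
  parameter_function F phi /\
  exists s : nat, exists psi : 'M[R]_(s.+1, n) -> 'rV[R]_m,
    smooth psi /\
    forall (I : set R) (x : R -> 'rV[R]_n) (y : R -> 'rV[R]_m),
      is_solution F I x -> smooth_on I y ->
      ((forall t, I t -> x t = phi (jet r y t)) <->
       (forall t, I t -> y t = psi (jet s x t))).

Definition differentially_flat
    (F : 'rV[R]_n * 'rV[R]_n -> 'rV[R]_(n - m)) : Prop :=
  exists r : nat, exists phi : 'M[R]_(r.+1, m) -> 'rV[R]_n,
    associated_to_flat F phi.

(* (y_0, ..., y_r) from (y_0, ..., y_{r+1}) *)
Definition jet_trunc (r : nat) (Y : 'M[R]_(r.+2, m)) : 'M[R]_(r.+1, m) :=
  \matrix_(i < r.+1) row (widen_ord (leqnSn r.+1) i) Y.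

(* (d phi / d y_i) (Y) v: derivative of phi at Y along the matrix whose i-th
   row is v and whose other rows vanish. *)
Definition block_partial (r : nat) (phi : 'M[R]_(r.+1, m) -> 'rV[R]_n)
    (i : 'I_r.+1) (Y : 'M[R]_(r.+1, m)) (v : 'rV[R]_m) : 'rV[R]_n :=
  'D_(\matrix_(k < r.+1) (if k == i then v else 0)) phi Y.

Definition Ltau (r : nat) (phi : 'M[R]_(r.+1, m) -> 'rV[R]_n)
    (Y : 'M[R]_(r.+2, m)) : 'rV[R]_n :=
  \sum_(i < r.+1) block_partial phi i (jet_trunc Y) (row (lift ord0 i) Y).

Definition Phi_map (r : nat) (phi : 'M[R]_(r.+1, m) -> 'rV[R]_n)
    (Y : 'M[R]_(r.+2, m)) : 'rV[R]_n * 'rV[R]_n :=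
  (phi (jet_trunc Y), Ltau phi Y).

End ControlSystem.

(* Main.v *)
From HB Require Import structures.
Require Import Defs.
From mathcomp Require Import ring lra.
Import Order.TTheory GRing.Theory Num.Theory.
Import numFieldNormedType.Exports.
Local Open Scope ring_scope.
Local Open Scope classical_set_scope.
Set Implicit Arguments.
Unset Strict Implicit.
Unset Printing Implicit Defensive.

(** The map [Phi] is a surjective submersion onto [M = {F = 0}] because it has
smooth local sections through every point [Y] of its source: smooth maps [eta]
with [Phi \o eta = id] on [M] and [eta (Phi Y) = Y]. One section gives
surjectivity, and differentiating [Phi (eta (c t)) = c t] along a curve [c] of [M]
starting at [Phi Y] gives surjectivity of the differential at [Y]. The opposite
inclusions hold because every jet is the jet of a polynomial curve [y], along
which [Phi] is the 1-jet of the solution [phi (y, y', ...)].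

Flatness suggests the section: send [(x, p)] to the jet of
[y = psi (x, x', ...)] along some solution starting at [x] with velocity [p]. What
is needed is a choice of such solutions, with jets that depend smoothly on
[(x, p)] and that include one given solution [xbar = phi (y, y', ...)]. They are
taken to be the integral curves of the second-order field [constrained_field]
on [(x, p, t)]:

    [x' = p],   [p' = xbar''(t) - A (dF(x, p)(p, xbar''(t)))],   [t' = 1],

with [A] the Moore-Penrose right inverse of the surjection [dF/dp]. The
correction term makes [F (x, p)] constant along these curves, so that those
starting on [M] are solutions ([constrained_field_invariant]), and it vanishes
along [(xbar, xbar', t)], which is thus one of them ([constrained_field_lift]).

The jets depend smoothly on the initial state for an algebraic reason: along
an integral curve, the time derivatives of a function of the state are its
iterated Lie derivatives ([derive1n_integral_curve]), so the jet of [y] at the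
initial time is a smooth function of the initial state. The integral curves
themselves, which provide the actual solutions that flatness speaks about, come
from Picard iteration ([picard_row]). *)

(** * Functions of class C^k *)

Section FunctionAlgebra.
Variable R : realType.
Implicit Types U V W : normedModType R.

Lemma linear_diff V W (L : V -> W) (x : V) : linear L -> continuous L ->
  differentiable L x /\ 'd L x = L :> (V -> W).
Proof.
move=> linL cL.
pose LM := GRing.isLinear.Build _ _ _ _ _ linL.
pose L' : {linear V -> W} := HB.pack L LM.
split; first exact: (@linear_differentiable _ _ _ L' x cL).
exact: (@diff_lin _ _ _ L' x cL).
Qed.

(** Differentiability is a germ property; this makes the values of a function
outside an open set irrelevant to its class there ([Ck_ext]). *)
Lemma near_eq_differentiable V W (f g : V -> W) x :
  (\near x, f x = g x) -> differentiable f x -> differentiable g x.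
Proof.
move=> fg df; have gx := nbhs_singleton fg.
have key : g \o shift x = cst (g x) + 'd f x +o_ 0 id.
  apply/eqaddoP => e e0.
  have /eqaddoP/(_ e e0) := diff_locally df.
  have : \forall h \near 0, f (h + x) = g (h + x).
    by move: fg; rewrite (near_shift 0 x) /= subr0.
  by apply: filter_app2; near=> h => E; rewrite /= !fctE /= -E -gx.
have dgf := diff_unique (diff_continuous df) key.
apply/diff_locallyP; split; first by rewrite dgf; exact: diff_continuous.
by rewrite dgf.
Unshelve. all: by end_near. Qed.

(** [Ck_on] quantifies over the directional derivatives of a function as
global objects, so differentiation rules valid only on [D] can be fed into an
induction on the order of differentiability only through this lemma. *)
Lemma Ck_ext V W k D (f g : V -> W) : open D -> (forall x, D x -> f x = g x) ->
  Ck_on k D f -> Ck_on k D g.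
Proof.
move=> oD.
have near_D h1 h2 x : (forall x, D x -> h1 x = h2 x) -> D x ->
    \near x, h1 x = h2 x :> W.
  by move=> E Dx; near=> y; apply: E; near: y; exact: open_nbhs_nbhs.
elim: k f g => [|k IH] f g fg /=.
  move=> cf x Dx; rewrite /prop_for /continuous_at -(fg _ Dx).
  by apply: cvg_trans (cf x Dx); apply: near_eq_cvg; exact: near_D.
move=> [df Df]; split=> [x Dx|v].
  by apply: near_eq_differentiable (df x Dx); exact: near_D.
by apply: IH (Df v) => x Dx; apply: near_eq_derive; exact: near_D.
Unshelve. all: by end_near. Qed.

Lemma Ck_diff V W k D (f : V -> W) x : Ck_on k.+1 D f -> D x -> differentiable f x.
Proof. by case=> df _ /df. Qed.

Lemma Ck_pred V W k D (f : V -> W) : Ck_on k.+1 D f -> Ck_on k D f.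
Proof.
elim: k f => [|k IH] f [df Df].
  by move=> x Dx; apply: differentiable_continuous; exact: df.
by split=> // v; apply: IH.
Qed.

Lemma Ck_cst V W k D (w : W) : Ck_on k D (cst w : V -> W).
Proof.
elim: k w => [|k IH] w /=; first by move=> x _; exact: cst_continuous.
split=> [x _|v]; first exact: differentiable_cst.
rewrite (_ : 'D_v (cst w) = cst 0) //.
by apply/funext => x; rewrite derive_cst.
Qed.

Lemma Ck_add V W k D (f g : V -> W) : open D -> Ck_on k D f -> Ck_on k D g ->
  Ck_on k D (fun x => f x + g x).
Proof.
move=> oD; elim: k f g => [|k IH] f g.
  by move=> cf cg x Dx; apply: continuousD; [exact: cf|exact: cg].
move=> Cf Cg; split=> [x Dx|v].
  by apply: differentiableD; [exact: Ck_diff Cf Dx|exact: Ck_diff Cg Dx].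
apply: (Ck_ext oD _ (IH _ _ (Cf.2 v) (Cg.2 v))) => x Dx.
by rewrite -deriveD//; apply: diff_derivable; [exact: Ck_diff Cf Dx|exact: Ck_diff Cg Dx].
Qed.

Lemma Ck_sum V W k D (I : Type) (r : seq I) (P : pred I) (f : I -> V -> W) :
  open D -> (forall i, P i -> Ck_on k D (f i)) ->
  Ck_on k D (fun x => \sum_(i <- r | P i) f i x).
Proof.
move=> oD Cf; elim: r => [|i r IH].
  have -> : (fun x => \sum_(j <- [::] | P j) f j x) = cst 0.
    by apply/funext => x; rewrite big_nil.
  exact: Ck_cst.
have -> : (fun x => \sum_(j <- i :: r | P j) f j x) =
    fun x => (if P i then f i x else 0) + \sum_(j <- r | P j) f j x.
  by apply/funext => x; rewrite big_cons; case: ifP => // _; rewrite add0r.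
by apply: Ck_add => //; case Pi: (P i); [exact: Cf|exact: Ck_cst].
Qed.

Lemma deriveE_comp U V W (f : U -> V) (g : V -> W) x v :
  differentiable f x -> differentiable g (f x) ->
  'D_v (g \o f) x = 'd g (f x) ('D_v f x).
Proof.
move=> df dg; rewrite !deriveE //; last exact: differentiable_comp.
by rewrite diff_comp.
Qed.

Lemma Ck_lin V W W' k D (L : W -> W') (f : V -> W) : open D ->
  linear L -> continuous L -> Ck_on k D f -> Ck_on k D (fun x => L (f x)).
Proof.
move=> oD linL cL; elim: k f => [|k IH] f.
  move=> cf x Dx; apply: continuous_comp; [exact: cf|exact: cL].
move=> Cf; split=> [x Dx|v].
  apply: differentiable_comp; [exact: Ck_diff Cf Dx|exact: (linear_diff _ linL cL).1].
apply: (Ck_ext oD _ (IH _ (Cf.2 v))) => x Dx.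
have [dL dLE] := linear_diff (f x) linL cL.
by rewrite [RHS](deriveE_comp v (Ck_diff Cf Dx) dL) dLE.
Qed.

Lemma Ck_id V k D : Ck_on k D (@id V).
Proof.
case: k => [|k] /=; first by move=> x _ ; exact: cvg_id.
split=> [x _|v]; first by [].
rewrite (_ : 'D_v id = cst v); first exact: Ck_cst.
by apply/funext => x; rewrite derive_id.
Qed.

Lemma diff_scale V W (a : V -> R) (f : V -> W) x :
  differentiable a x -> differentiable f x ->
  differentiable (fun x => a x *: f x) x /\
  forall v, 'd (fun x => a x *: f x) x v = a x *: 'd f x v + 'd a x v *: f x.
Proof.
move=> da df.
have bil : bilinear_for
    (GRing.Scale.Law.clone _ _ *:%R _) (GRing.Scale.Law.clone _ _ *:%R _)
    (fun (a : R^o) (w : W) => a *: w).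
  split=> [u'|u] b y z /=; first by rewrite scalerDl scalerA.
  by rewrite scalerDr !scalerA mulrC.
pose BM := bilinear_isBilinear.Build R _ _ _ _ _ _ bil.
pose B : {bilinear R^o -> W -> W} := HB.pack (fun (a : R^o) (w : W) => a *: w) BM.
have cB : continuous (fun p : R^o * W => B p.1 p.2) by exact: scale_continuous.
have dp := differentiable_pair da df.
have dB := differentiable_bilin (a x, f x) cB.
split; first exact: (differentiable_comp dp dB).
move=> v; have := diff_comp dp dB.
rewrite /comp /= => ->; rewrite (diff_bilin _ cB) /=.
by rewrite diff_pair.
Qed.

Lemma Ck_scale V W k D (a : V -> R) (f : V -> W) : open D ->
  Ck_on k D a -> Ck_on k D f -> Ck_on k D (fun x => a x *: f x).
Proof.
move=> oD; elim: k a f => [|k IH] a f.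
  by move=> ca cf x Dx; apply: cvgZ; [exact: ca|exact: cf].
move=> Ca Cf; split=> [x Dx|v].
  by apply: (diff_scale _ _).1; [exact: Ck_diff Ca Dx|exact: Ck_diff Cf Dx].
have C1 := IH _ _ (Ck_pred Ca) (Cf.2 v).
have C2 := IH _ _ (Ca.2 v) (Ck_pred Cf).
apply: (Ck_ext oD _ (Ck_add oD C1 C2)) => x Dx.
have [da df] := (Ck_diff Ca Dx, Ck_diff Cf Dx).
have [d1 d2] := diff_scale da df.
by rewrite /= (deriveE v d1) (deriveE v df) (deriveE v da) d2.
Qed.

(** Induction from [(1/a)' = - a' / a^2], where [1/a] is already of the
previous class. *)
Lemma Ck_inv V k D (a : V -> R) : open D -> (forall x, D x -> a x != 0) ->
  Ck_on k D a -> Ck_on k D (fun x => (a x)^-1).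
Proof.
move=> oD a0; elim: k => [|k IH] Ca.
  by move=> x Dx; apply: cvgV; [exact: a0|exact: Ca].
have CV := IH (Ck_pred Ca).
split=> [x Dx|v].
  by apply: differentiableV; [exact: Ck_diff Ca Dx|exact: a0].
have C1 := Ck_scale oD CV (Ck_scale oD CV (Ca.2 v)).
have C2 := Ck_scale oD (@Ck_cst V R^o k D (-1)) C1.
apply: (Ck_ext oD _ C2) => x Dx.
have da := Ck_diff Ca Dx.
rewrite [in RHS]deriveE; last by apply: differentiableV => //; exact: a0.
rewrite diffV ?a0//= -deriveE//.
by rewrite /cst !scalerA -mulrA mulN1r -invfM -expr2.
Qed.

Lemma Ck_pair V W W' k D (f : V -> W) (g : V -> W') : open D ->
  Ck_on k D f -> Ck_on k D g -> Ck_on k D (fun x => (f x, g x)).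
Proof.
move=> oD; elim: k f g => [|k IH] f g.
  by move=> cf cg x Dx; apply: cvg_pair; [exact: cf|exact: cg].
move=> Cf Cg; split=> [x Dx|v].
  by apply: differentiable_pair; [exact: Ck_diff Cf Dx|exact: Ck_diff Cg Dx].
apply: (Ck_ext oD _ (IH _ _ (Cf.2 v) (Cg.2 v))) => x Dx.
have [d1 d2] := (Ck_diff Cf Dx, Ck_diff Cg Dx).
by rewrite !deriveE ?diff_pair//; exact: differentiable_pair.
Qed.

(** Coordinates are explicit because they are what the proofs consume:
expanding a direction [v] along the [b i] turns [dh(x)(v)] into a combination
of the partial derivatives ['D_(b i) h], the only higher-order data [Ck_on]
gives access to. *)
Definition finite_dim V := exists N (b : 'I_N -> V) (l : 'I_N -> V -> R^o),
  (forall i, linear (l i) /\ continuous (l i)) /\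
  forall v, v = \sum_i l i v *: b i.

Lemma finite_dim_linear_continuous V W (L : V -> W) :
  finite_dim V -> linear L -> continuous L.
Proof.
move=> [N [b [l [ll lE]]]] linL.
pose LM := GRing.isLinear.Build _ _ _ _ _ linL.
pose L' : {linear V -> W} := HB.pack L LM.
have -> : L = fun v => \sum_i l i v *: L (b i).
  apply/funext => v; rewrite {1}(lE v) -[L]/(L' : V -> W) linear_sum.
  by apply: eq_bigr => i _; rewrite linearZ.
move=> v; apply: (@cvg_big _ _ +%R 0 xpredT) => [|i _]; first exact: add_continuous.
by apply: cvgZr_tmp; exact: (ll i).2.
Qed.

Lemma finite_dim_R : finite_dim R^o.
Proof.
exists 1%N, (fun=> 1), (fun=> id); split=> [_|v].
  by split=> // x; exact: cvg_id.
by rewrite big_ord1 [_ *: _]mulr1.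
Qed.

Lemma sum_pair V W (I : finType) (F : I -> V * W) :
  \sum_i F i = (\sum_i (F i).1, \sum_i (F i).2).
Proof. by elim/big_rec3 : _ => // i x y z _ ->. Qed.

Lemma finite_dim_pair V W : finite_dim V -> finite_dim W -> finite_dim (V * W)%type.
Proof.
move=> [N [b [l [ll lE]]]] [M [c [m [mm mE]]]].
exists (N + M)%N,
  (fun i => match fintype.split i with inl i => (b i, 0) | inr j => (0, c j) end),
  (fun i v => match fintype.split i with inl i => l i v.1 | inr j => m j v.2 end).
split=> [i|[v w]].
  case: (fintype.split i) => j; split.
  - by move=> a u v /=; rewrite (ll j).1.
  - move=> v; apply: continuous_comp; first exact: cvg_fst.
    exact: (ll j).2.
  - by move=> a u v /=; rewrite (mm j).1.
  - move=> v; apply: continuous_comp; first exact: cvg_snd.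
    exact: (mm j).2.
rewrite big_split_ord /=.
under eq_bigr do rewrite (unsplitK (inl _)) /=.
under [X in _ + X]eq_bigr do rewrite (unsplitK (inr _)) /=.
rewrite !sum_pair /=; congr (_, _) => /=.
  by rewrite -lE [X in _ + X]big1 ?addr0// => j _; rewrite scaler0.
by rewrite -mE [X in X + _]big1 ?add0r// => j _; rewrite scaler0.
Qed.

Lemma finite_dim_mx m n : finite_dim 'M[R]_(m, n).
Proof.
exists #|{: 'I_m * 'I_n}|,
  (fun k => delta_mx (enum_val k).1 (enum_val k).2),
  (fun k (A : 'M[R]_(m, n)) => A (enum_val k).1 (enum_val k).2).
split=> [k|A].
  by split=> [a u v|]; [rewrite !mxE|exact: coord_continuous].
rewrite {1}(matrix_sum_delta A) pair_big /= (reindex (@enum_val _ {: 'I_m * 'I_n})) //=.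
by apply: onW_bij; exact: enum_val_bij.
Qed.

Lemma Ck_entries V m n k D (M : V -> 'M[R]_(m, n)) : open D ->
  (forall i j, Ck_on k D (fun x => M x i j : R)) -> Ck_on k D M.
Proof.
move=> oD CM.
rewrite (_ : M = fun x => \sum_i \sum_j M x i j *: delta_mx i j); last first.
  by apply/funext => x; exact: matrix_sum_delta.
apply: Ck_sum => // i _; apply: Ck_sum => // j _.
by apply: Ck_scale => //; exact: Ck_cst.
Qed.

Lemma Ck_entry V m n k D (M : V -> 'M[R]_(m, n)) i j : open D ->
  Ck_on k D M -> Ck_on k D (fun x => M x i j : R).
Proof.
move=> oD; apply: (Ck_lin (L := fun A : 'M[R]_(m, n) => A i j : R^o)) => //.
  by move=> a u v; rewrite !mxE.
exact: coord_continuous.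
Qed.

(** The derivative of a composite is [x |-> dh(f x)(f'(x))], where the point
and the direction both move. Expanding the direction in coordinates reduces it
to composites [('D_(e i) h) \o a] of the same order [k]. Composition is a
hypothesis here since its own proof is an induction that uses this lemma. *)
Lemma Ck_comp_diff U V W k (A : set U) (B : set V) (h : V -> W) :
  finite_dim V -> open A -> open B -> Ck_on k.+1 B h ->
  (forall k' (h' : V -> W) (f : U -> V), (k' <= k)%N -> Ck_on k' B h' ->
     Ck_on k' A f -> (forall x, A x -> B (f x)) -> Ck_on k' A (h' \o f)) ->
  forall (a b : U -> V), Ck_on k A a -> Ck_on k A b ->
  (forall x, A x -> B (a x)) -> Ck_on k A (fun x => 'd h (a x) (b x)).
Proof.
move=> [N [e [l [ll lE]]]] oA oB Ch comp a b Ca Cb aB.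
apply: (@Ck_ext _ _ _ _ (fun x => \sum_i l i (b x) *: 'D_(e i) h (a x))) => //.
  move=> x Ax; rewrite [in RHS](lE (b x)) linear_sum; apply: eq_bigr => i _.
  by rewrite linearZ /= deriveE //; exact: Ck_diff Ch (aB _ Ax).
apply: Ck_sum => // i _; apply: Ck_scale => //.
  by apply: Ck_lin => //; [exact: (ll i).1|exact: (ll i).2].
by apply: (comp k ('D_(e i) h) a) => //; exact: Ch.2.
Qed.

Lemma Ck_comp U V W k (A : set U) (B : set V) (h : V -> W) (f : U -> V) :
  finite_dim V -> open A -> open B -> Ck_on k B h -> Ck_on k A f ->
  (forall x, A x -> B (f x)) -> Ck_on k A (h \o f).
Proof.
move=> fV oA oB; elim: k {-2}k (leqnn k) h f => [|K IH] k.
  rewrite leqn0 => /eqP -> h f Ch Cf fB x Ax.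
  by apply: continuous_comp; [exact: Cf|exact/Ch/fB].
case: k => [_|k kK] h f Ch Cf fB; first exact: IH.
split=> [x Ax|v].
  by apply: differentiable_comp; [exact: Ck_diff Cf Ax|exact: Ck_diff Ch (fB _ Ax)].
have IHk k' (h' : V -> W) (f' : U -> V) : (k' <= k)%N -> Ck_on k' B h' ->
     Ck_on k' A f' -> (forall x, A x -> B (f' x)) -> Ck_on k' A (h' \o f').
  by move=> k'k; apply: IH; exact: leq_trans k'k kK.
apply: (Ck_ext oA _ (Ck_comp_diff fV oA oB Ch IHk (Ck_pred Cf) (Cf.2 v) fB)).
move=> x Ax; rewrite deriveE_comp //; first exact: Ck_diff Cf Ax.
exact: Ck_diff Ch (fB _ Ax).
Qed.

Lemma is_derive_scalel V (a : R -> R) (t a' : R) (v : V) :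
  is_derive t (1 : R) a a' -> is_derive t (1 : R) (fun s => a s *: v) (a' *: v).
Proof.
move=> [/derivable1_diffP da <-]; split.
  by apply/derivable1_diffP; exact: differentiableZl.
by rewrite !deriveE ?diffZl//; exact: differentiableZl.
Qed.

Lemma is_derive_line V (a v : V) (t : R) :
  is_derive t (1 : R) (fun s => a + s *: v) v.
Proof.
have := is_derive_scalel v (is_derive_id t (1 : R)); rewrite scale1r => dv.
by have := is_deriveD (is_derive_cst a t (1 : R)) dv; rewrite add0r.
Qed.

Lemma is_derive_pair V W (a : R -> V) (b : R -> W) (t : R) a' b' :
  is_derive t (1 : R) a a' -> is_derive t (1 : R) b b' ->
  is_derive t (1 : R) (fun s => (a s, b s)) (a', b').
Proof.
move=> [/derivable1_diffP da <-] [/derivable1_diffP db <-]; split.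
  by apply/derivable1_diffP; exact: differentiable_pair.
by rewrite !deriveE ?diff_pair//; exact: differentiable_pair.
Qed.

End FunctionAlgebra.

(** * Mean value inequality and Lipschitz bounds *)

Section MeanValue.
Variable R : realType.

Lemma row_norm_le N (v : 'rV[R]_N) (K : R) : 0 <= K ->
  (forall i, `|v 0 i| <= K) -> `|v| <= K.
Proof.
move=> K0 vK; rewrite [leLHS]/Num.Def.normr/= mx_normrE.
by apply: bigmax_le => //= -[i j] _ /=; rewrite (ord1 i).
Qed.

Lemma row_entry_norm N (v : 'rV[R]_N) i : `|v 0 i| <= `|v|.
Proof.
rewrite [leRHS]/Num.Def.normr/= mx_normrE.
exact: (le_bigmax _ (fun p : 'I_1 * 'I_N => `|v p.1 p.2|) (0, i)).
Qed.

(** Integrating from [-1] makes the first fundamental theorem of calculus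
apply on both sides of [0]. *)
Lemma antiderivative_R (h : R -> R) : continuous h ->
  exists H : R -> R, H 0 = 0 /\ forall t, `|t| < 1 -> is_derive t (1 : R) H (h t).
Proof.
move=> ch.
pose F x := (\int[lebesgue_measure]_(t in [set` `[(-1) : R, x]]) (h t))%R.
have dF t : `|t| < 1 -> is_derive t (1 : R) F (h t).
  rewrite ltr_norml => /andP[t1 t2].
  have [] := @continuous_FTC1_closed R h (-1) t 1 t2 _ t1 (ch t).
    apply: continuous_compact_integrable; first exact: segment_compact.
    by apply: continuous_subspaceT.
  by move=> d e; apply: DeriveDef; [exact: d|rewrite -derive1E; exact: e].
exists (fun t => F t - F 0); split=> [|t /dF dt]; first by rewrite subrr.
have -> : (fun t => F t - F 0) = F - cst (F 0) by [].
by rewrite -[h t]subr0; apply: is_deriveB.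
Qed.

Lemma is_derive_row N (H : R -> 'rV[R]_N) (t : R) (v : 'rV[R]_N) :
  (forall i, is_derive t (1 : R) (fun s => H s 0 i) (v 0 i)) -> is_derive t (1 : R) H v.
Proof.
move=> d; have dH : derivable H t 1.
  apply: (derivable_mxP H t (1 : R)).2 => i j; by rewrite (ord1 i); case: (d j).
split=> //; rewrite derive_mx //; apply/rowP => j; rewrite mxE.
by case: (d j).
Qed.

Lemma is_derive_row_entry N (H : R -> 'rV[R]_N) (t : R) (v : 'rV[R]_N) i :
  is_derive t (1 : R) H v -> is_derive t (1 : R) (fun s => H s 0 i : R) (v 0 i).
Proof.
move=> [dH <-]; split; first by move/derivable_mxP : dH.
by rewrite derive_mx // mxE.
Qed.

Lemma antiderivative N (h : R -> 'rV[R]_N) : continuous h ->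
  exists H : R -> 'rV[R]_N,
    H 0 = 0 /\ forall t, `|t| < 1 -> is_derive t (1 : R) H (h t).
Proof.
move=> ch.
have /choice[H HP] : forall i : 'I_N, exists H : R -> R,
    H 0 = 0 /\ forall t, `|t| < 1 -> is_derive t (1 : R) H (h t 0 i).
  move=> i; apply: (@antiderivative_R (fun t => h t 0 i)) => t.
  apply: (@continuous_comp _ _ _ h (fun v : 'rV[R]_N => v 0 i)); first exact: ch.
  exact: coord_continuous.
exists (fun t => \row_i H i t); split=> [|t t1].
  by apply/rowP => i; rewrite !mxE (HP i).1.
apply: is_derive_row => i.
rewrite (_ : (fun s => _) = H i); first exact: (HP i).2.
by apply/funext => s; rewrite mxE.
Qed.

(** Coordinatewise mean value theorem, combined by the sup norm on rows. *)
Lemma mean_value N (H h : R -> 'rV[R]_N) (a b K : R) : a <= b ->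
  (forall t, a <= t <= b -> is_derive t (1 : R) H (h t)) ->
  (forall t, a <= t <= b -> `|h t| <= K) -> `|H b - H a| <= K * (b - a).
Proof.
move=> ab dH hK.
have K0 : 0 <= K by apply: le_trans (hK a _); rewrite // lexx.
apply: row_norm_le => [|i]; first by rewrite mulr_ge0 ?subr_ge0.
have di t : a <= t <= b -> is_derive t (1 : R) (fun s => H s 0 i : R) (h t 0 i).
  by move=> /dH; exact: is_derive_row_entry.
have [t tab||c cab] := @MVT_segment R (fun s => H s 0 i) (fun s => h s 0 i) a b ab.
- apply: di; rewrite in_itv/= in tab; lra.
- apply: derivable_within_continuous => t tab.
  by rewrite in_itv /= in tab; case: (di t tab).
rewrite !mxE => ->; rewrite normrM [X in _ * X]ger0_norm ?subr_ge0//.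
rewrite ler_wpM2r ?subr_ge0//; apply: le_trans (row_entry_norm _ _) _.
by apply: hK; rewrite in_itv in cab.
Qed.

Lemma mean_value0 N (H h : R -> 'rV[R]_N) (t K : R) : `|t| < 1 -> H 0 = 0 ->
  (forall t, `|t| < 1 -> is_derive t (1 : R) H (h t)) ->
  (forall t, `|h t| <= K) -> `|H t| <= K * `|t|.
Proof.
rewrite ltr_norml => t1 H0 dH hK.
have [t0|t0] := leP 0 t.
  have := @mean_value N H h 0 t K t0; rewrite H0 !subr0 ger0_norm //; apply => // s st.
  by apply: dH; rewrite ltr_norml; lra.
have := @mean_value N H h t 0 K (ltW t0); rewrite H0 !sub0r normrN ltr0_norm //.
by apply => // s st; apply: dH; rewrite ltr_norml; lra.
Qed.

(** The partial derivatives are continuous, hence bounded on a ball; the mean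
value inequality along the segment from [b] to [a], which stays in the ball by
convexity, gives the constant. *)
Lemma C1_lipschitz N (g : 'rV[R]_N -> 'rV[R]_N) z0 : Ck_on 1 setT g ->
  exists2 rho : R, 0 < rho & exists2 L : R, 0 <= L & forall a b,
    `|a - z0| <= rho -> `|b - z0| <= rho -> `|g a - g b| <= L * `|a - b|.
Proof.
move=> [dg Dg].
pose K := \sum_(j < N) `|'D_(delta_mx 0 j) g z0| + 1.
have : \forall z \near z0, forall j : 'I_N, `|'D_(delta_mx 0 j) g z| <= K.
  apply: (@filter_forall _ 'I_N
    (fun j z => is_true (`|'D_(delta_mx 0 j) g z| <= K)) _ (nbhs_filter z0)) => j.
  have /cvgrPdist_lt/(_ 1 ltr01) := Dg (delta_mx 0 j) z0 I.
  apply: filterS => z zj; rewrite /K (bigD1 j)//=.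
  have := ler_normB ('D_(delta_mx 0 j) g z0)
    ('D_(delta_mx 0 j) g z0 - 'D_(delta_mx 0 j) g z).
  rewrite subKr => /le_trans; apply.
  rewrite -addrA lerD2l (le_trans (ltW zj))// lerDr.
  by apply: sumr_ge0.
move=> /nbhs_ballP[e /= e0 eK].
exists (e / 2); first by rewrite divr_gt0.
exists (N%:R * K) => [|a b az bz].
  rewrite mulr_ge0// /K addr_ge0//; exact: sumr_ge0.
pose c (s : R) := b + s *: (a - b).
have dc s : is_derive s (1 : R) c (a - b) by exact: is_derive_line.
have -> : g a - g b = (g \o c) 1 - (g \o c) 0.
  by rewrite /= /c scale1r scale0r addr0 addrCA subrr addr0.
have -> : N%:R * K * `|a - b| = N%:R * K * `|a - b| * (1 - 0) by rewrite subr0 mulr1.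
apply: (@mean_value N _ (fun s => 'd g (c s) (a - b))) => // s s01.
  have dcs : differentiable c s by apply/derivable1_diffP/ex_derive.
  split; first by apply/derivable1_diffP; apply: differentiable_comp => //; exact: dg.
  by rewrite deriveE_comp ?derive_val//; exact: dg.
have cs : ball z0 e (c s).
  rewrite -ball_normE /= /c.
  have -> : z0 - (b + s *: (a - b)) = - ((1 - s) *: (b - z0) + s *: (a - z0)).
    by apply/rowP => i; rewrite !mxE; ring.
  rewrite normrN; apply: (le_lt_trans (ler_normD _ _)); rewrite !normrZ.
  rewrite !ger0_norm; try lra.
  apply: (@le_lt_trans _ _ ((1 - s) * (e / 2) + s * (e / 2))); last by lra.
  by apply: lerD; apply: ler_wpM2l => //; lra.
rewrite (row_sum_delta (a - b)) linear_sum /=.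
apply: (le_trans (ler_norm_sum _ _ _)).
rewrite -mulrA mulr_natl -[X in _ *+ X](card_ord N) -sumr_const.
apply: ler_sum => j _; rewrite linearZ normrZ /= mulrC ler_pM//.
  by rewrite -deriveE; [exact: eK|exact: dg].
by rewrite -row_sum_delta; exact: row_entry_norm.
Qed.

End MeanValue.

(** * Local existence for ordinary differential equations *)

Section Picard.
Variable R : realType.

Lemma geometric_small (C e : R) : 0 < e -> exists k, C * 2^-1 ^+ k < e.
Proof.
move=> e0; have h : `|2^-1 : R| < 1 by rewrite ger0_norm; lra.
have /cvgrPdist_lt/(_ e e0)[k _ /(_ k (leqnn k))] := cvg_geometric C h.
rewrite /= sub0r normrN => hk; exists k.
by apply: le_lt_trans (ler_norm _) hk.
Qed.

Lemma geometric_cauchy_cvg N (z : nat -> 'rV[R]_N) (C : R) :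
  (forall k, `|z k.+1 - z k| <= C * 2^-1 ^+ k) ->
  exists l, forall k, `|z k - l| <= 2 * C * 2^-1 ^+ k.
Proof.
move=> zC.
have C0 : 0 <= C by have := zC 0%N; rewrite expr0 mulr1; apply: le_trans.
(* 2 (1 - 2^-m) is the sum of the first m powers of 1/2; unlike the bound by 2,
   it is preserved by an induction on m *)
have far k m : `|z (k + m)%N - z k| <= 2 * C * 2^-1 ^+ k * (1 - 2^-1 ^+ m).
  elim: m => [|m IH]; first by rewrite addn0 subrr normr0 expr0 subrr mulr0.
  rewrite addnS -(subrKA (z (k + m)%N)).
  apply: (le_trans (ler_normD _ _)); apply: (le_trans (lerD (zC _) IH)).
  by rewrite exprD exprS le_eqVlt; apply/orP; left; apply/eqP; field.
have half0 m : 0 <= (2^-1 : R) ^+ m by rewrite exprn_ge0.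
have far2 k m : `|z (k + m)%N - z k| <= 2 * C * 2^-1 ^+ k.
  by apply: (le_trans (far k m)); have := half0 m; rewrite ler_piMr ?mulr_ge0//; lra.
have cz : cvgn z.
  apply/cauchy_cvgP/cauchy_ballP => e e0; near_simpl.
  have [k ke] := @geometric_small (2 * (2 * C)) e e0.
  exists ([set n | k <= n]%N, [set n | k <= n]%N); first by split; exists k.
  move=> [n m] [/= kn km]; rewrite -ball_normE /= -(subrKA (z k)).
  apply: (le_lt_trans (ler_normD _ _)); rewrite [X in _ + X]distrC.
  rewrite -(subnKC kn) -(subnKC km).
  apply: le_lt_trans (lerD (far2 _ _) (far2 _ _)) _.
  by lra.
exists (limn z) => k; apply/ler_addgt0Pr => e e0.
have /cvgrPdist_lt/(_ e e0)[m _ /(_ (k + m)%N (leq_addl _ _)) mh] := cz.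
rewrite -(subrKA (z (k + m)%N)) (le_trans (ler_normD _ _))// lerD//.
  by rewrite distrC.
by apply: ltW; rewrite distrC.
Qed.

(** The retraction of the line onto [-d, d]. Composing with it makes every
Picard iterate a total function, uniformly bounded on the whole line although
antiderivatives are controlled near [0] only. *)
Definition clamp (d t : R) : R := Num.max (- d) (Num.min d t).

Lemma clamp_le d t : 0 <= d -> `|clamp d t| <= d.
Proof.
by move=> d0; rewrite /clamp ler_norml le_max lexx /= ge_max ge_min lexx /= andbT; lra.
Qed.

Lemma clamp_id d t : `|t| <= d -> clamp d t = t.
Proof.
by rewrite ler_norml => /andP[td dt]; rewrite /clamp (min_idPr dt) (max_idPr td).
Qed.

Lemma clamp_continuous d : continuous (clamp d).
Proof.
move=> t; apply: (@continuous_max _ _ (cst (- d)) (cst d \min id)).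
  exact: cst_continuous.
by apply: (@continuous_min _ _ (cst d) id); [exact: cst_continuous|exact: cvg_id].
Qed.

(** Picard iteration for [z' = g z]. With [M] a bound and [L] a Lipschitz
constant of [g] on the ball of radius [rho] around [z0], the operator
[w |-> z0 + antiderivative of g \o w] preserves the functions with values in that
ball and halves distances as soon as [M d <= rho] and [L d <= 1/2]. *)
Lemma picard_row N (g : 'rV[R]_N -> 'rV[R]_N) z0 : Ck_on 1 setT g ->
  exists d : R, exists z : R -> 'rV[R]_N,
    [/\ 0 < d, z 0 = z0 & forall t, `|t| < d -> is_derive t (1 : R) z (g (z t))].
Proof.
move=> Cg; have cg : continuous g by move=> x; exact: (Ck_pred Cg).
have [rho rho0 [L L0 gL]] := C1_lipschitz z0 Cg.
pose M := `|g z0| + L * rho.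
have gM a : `|a - z0| <= rho -> `|g a| <= M.
  move=> az; rewrite -(subrK (g z0) (g a)) addrC (le_trans (ler_normD _ _))// lerD2l.
  apply: (le_trans (gL _ _ az _)); first by rewrite subrr normr0 ltW.
  exact: ler_wpM2l.
have M0 : 0 <= M by rewrite addr_ge0// mulr_ge0// ltW.
have [A AP] : exists A : (R -> 'rV[R]_N) -> R -> 'rV[R]_N, forall h, continuous h ->
    A h 0 = 0 /\ forall t, `|t| < 1 -> is_derive t (1 : R) (A h) (h t).
  have /choice[A AP] : forall h : R -> 'rV[R]_N, exists H : R -> 'rV[R]_N,
      continuous h -> H 0 = 0 /\ forall t, `|t| < 1 -> is_derive t (1 : R) H (h t).
    move=> h; have [/antiderivative[H HP]|nh] := pselect (continuous h).
      by exists H.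
    by exists h.
  by exists A.
(* one choice of d that ensures d < 1, L d <= 1/2 and M d <= rho at once *)
pose d := (1 + 1 + 2 * L + M / rho)^-1.
have Mr : 0 <= M / rho by rewrite divr_ge0// ltW.
have d0 : 0 < d by rewrite invr_gt0; lra.
have dinv : d * (1 + 1 + 2 * L + M / rho) = 1 by rewrite mulVf//; apply: lt0r_neq0; lra.
have d1 : d < 1 by nra.
have dL : L * d <= 2^-1 by nra.
have dM : M * d <= rho.
  have : M / rho * d <= 1 by nra.
  by rewrite mulrAC ler_pdivrMr// mul1r.
pose good (w : R -> 'rV[R]_N) := continuous w /\ forall t, `|w t - z0| <= rho.
pose T (w : R -> 'rV[R]_N) t := z0 + A (g \o w) (clamp d t).
have clampd t : `|clamp d t| < 1 by apply: le_lt_trans d1; apply: clamp_le; exact: ltW.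
have cgw w : good w -> continuous (g \o w).
  by move=> [cw _] t; apply: continuous_comp; [exact: cw|exact: cg].
have Tgood w : good w -> good (T w).
  move=> gw; have [A0 dA] := AP _ (cgw _ gw); split=> t.
    apply: continuousD; first exact: cst_continuous.
    apply: continuous_comp; first exact: clamp_continuous.
    apply: differentiable_continuous; apply/derivable1_diffP.
    by case: (dA _ (clampd t)).
  rewrite /T addrC addKr.
  apply: (@le_trans _ _ (M * `|clamp d t|)).
    apply: (mean_value0 (clampd t) A0 dA) => s; apply: gM; exact: gw.2.
  by apply: le_trans dM; apply: ler_wpM2l => //; apply: clamp_le; exact: ltW.
have Tcontr w v (C : R) : good w -> good v -> (forall t, `|w t - v t| <= C) ->
    forall t, `|T w t - T v t| <= C / 2.
  move=> gw gv wv t.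
  have [Aw0 dAw] := AP _ (cgw _ gw); have [Av0 dAv] := AP _ (cgw _ gv).
  have C0 : 0 <= C by apply: le_trans (wv 0).
  rewrite /T opprD addrACA subrr add0r.
  pose H s := A (g \o w) s - A (g \o v) s.
  apply: (@le_trans _ _ (L * C * `|clamp d t|)).
    apply: (@mean_value0 _ _ H (fun s => g (w s) - g (v s))) => [||s s1|s].
    - exact: clampd.
    - by rewrite /H Aw0 Av0 subrr.
    - exact: (is_deriveB (dAw _ s1) (dAv _ s1)).
    apply: le_trans (gL _ _ (gw.2 s) (gv.2 s)) _; exact: ler_wpM2l.
  rewrite mulrAC mulrC; apply: ler_wpM2l => //.
  by apply: le_trans dL; apply: ler_wpM2l => //; apply: clamp_le; exact: ltW.
pose z_ k := iter k T (cst z0).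
have z_good k : good (z_ k).
  elim: k => [|k IH]; last exact: Tgood.
  by split=> t; [exact: cst_continuous|rewrite subrr normr0 ltW].
have z_step k t : `|z_ k.+1 t - z_ k t| <= rho * 2^-1 ^+ k.
  elim: k t => [|k IH] t.
    by rewrite expr0 mulr1; exact: (z_good 1%N).2.
  rewrite exprSr mulrA; exact: (Tcontr _ _ _ (z_good k.+1) (z_good k) IH).
have /choice[z zP] : forall t, exists l, forall k, `|z_ k t - l| <= 2 * rho * 2^-1 ^+ k.
  by move=> t; apply: (@geometric_cauchy_cvg _ (fun k => z_ k t)) => k; exact: z_step.
have zgood : good z.
  split=> t; last first.
    apply/ler_addgt0Pr => e e0.
    have [k ke] := geometric_small (2 * rho) e0.
    rewrite -(subrKA (z_ k t)) addrC (le_trans (ler_normD _ _))// lerD//.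
      exact: (z_good k).2.
    by rewrite distrC (le_trans (zP t k))// ltW.
  apply/cvgrPdist_lt => e e0.
  have e3 : 0 < e / 3 by rewrite divr_gt0.
  have [k ke] := geometric_small (2 * rho) e3.
  have /cvgrPdist_lt/(_ _ e3) := (z_good k).1 t.
  apply: filterS => s st.
  have h1 := le_lt_trans (zP t k) ke; have h2 := le_lt_trans (zP s k) ke.
  rewrite -(subrKA (z_ k t)) (le_lt_trans (ler_normD _ _))//.
  rewrite -(subrKA (z_ k s) (z_ k t)).
  rewrite [X in X + _]distrC.
  have := ler_normD (z_ k t - z_ k s) (z_ k s - z s); lra.
have Tz t : T z t = z t.
  apply/eqP; rewrite -subr_eq0 -normr_le0; apply/ler_addgt0Pr => e e0.
  rewrite add0r; have [k ke] := geometric_small (2 * (2 * rho)) e0.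
  rewrite -(subrKA (z_ k.+1 t)) (le_trans (ler_normD _ _))//.
  have h1 : `|T z t - z_ k.+1 t| <= 2 * rho * 2^-1 ^+ k / 2.
    apply: (Tcontr _ _ _ zgood (z_good k)) => s; by rewrite distrC.
  have h2 := zP t k.+1; rewrite exprSr in h2.
  have := exprn_ge0 k (_ : 0 <= 2^-1 :> R); lra.
have [A0 dA] := AP _ (cgw _ zgood).
exists d, z; split=> // [|t td].
  by rewrite -Tz /T clamp_id ?normr0 ?ltW// A0 addr0.
have td1 := lt_trans td d1.
have : is_derive t (1 : R) (fun s => z0 + A (g \o z) s) (g (z t)).
  by have := is_deriveD (is_derive_cst z0 t (1 : R)) (dA t td1); rewrite add0r.
apply: near_eq_is_derive; near=> s.
rewrite -Tz /T clamp_id//; apply: ltW; near: s.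
have /cvgrPdist_lt/(_ _ (_ : 0 < d - `|t|)) := @norm_continuous _ _ t.
rewrite subr_gt0 => /(_ td); apply: filterS => s.
by have := ler_norm (`|s| - `|t|); rewrite distrC; lra.
Unshelve. all: by end_near. Qed.

End Picard.

(** * Integral curves, Lie derivatives and jets *)

Section Curves.
Variable R : realType.
Implicit Types U V W : normedModType R.

Lemma smooth_on_diff V W D (f : V -> W) x : smooth_on D f -> D x -> differentiable f x.
Proof. by move=> Sf; exact: Ck_diff (Sf 1%N). Qed.

Lemma smooth_differentiable V W (f : V -> W) x : smooth f -> differentiable f x.
Proof. by move=> Sf; exact: smooth_on_diff Sf I. Qed.

Lemma smooth_on_comp U V W (A : set U) (B : set V) (h : V -> W) (f : U -> V) :
  finite_dim V -> open A -> open B -> smooth_on B h -> smooth_on A f ->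
  (forall x, A x -> B (f x)) -> smooth_on A (h \o f).
Proof. by move=> fV oA oB Sh Sf AB k; exact: (Ck_comp (B := B)). Qed.

Lemma smooth_comp_on U V W (A : set U) (h : V -> W) (f : U -> V) :
  finite_dim V -> open A -> smooth h -> smooth_on A f -> smooth_on A (h \o f).
Proof.
by move=> fV oA Sh Sf; apply: (smooth_on_comp (B := setT)) => //; exact: openT.
Qed.

Lemma smooth_linear V W (L : V -> W) :
  finite_dim V -> linear L -> smooth L.
Proof.
move=> fV linL k; apply: (Ck_lin (f := id)) => //; first exact: openT.
  exact: finite_dim_linear_continuous.
exact: Ck_id.
Qed.

Lemma smooth_diff_apply U V W (h : V -> W) (a b : U -> V) :
  finite_dim V -> smooth h -> smooth a -> smooth b ->
  smooth (fun x => 'd h (a x) (b x)).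
Proof.
move=> fV Sh Sa Sb k; apply: (Ck_comp_diff fV openT openT (Sh k.+1)) => //.
move=> k' h' f _ Ch Cf _; exact: (Ck_comp fV openT openT Ch Cf).
Qed.

Lemma is_derive_diff V W (h : V -> W) (c : R -> V) (t : R) v :
  differentiable h (c t) -> is_derive t (1 : R) c v ->
  is_derive t (1 : R) (h \o c) ('d h (c t) v).
Proof.
move=> dh [/derivable1_diffP dc <-]; split; last exact: deriveE_comp.
by apply/derivable1_diffP; exact: differentiable_comp.
Qed.

Lemma Ck_curve V k D (c : R -> V) : open D ->
  Ck_on k.+1 D c <-> (forall t, D t -> differentiable c t) /\ Ck_on k D (derive1 c).
Proof.
move=> oD; have dE : derive1 c = 'D_1 c by apply/funext => t; rewrite derive1E.
split=> [[dc Dc]|[dc Dc]]; first by rewrite dE; split=> //; exact: Dc.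
split=> // v; have := Ck_scale oD (@Ck_cst R R R^o k D v) Dc.
apply: Ck_ext => // t Dt; rewrite dE !deriveE; try exact: dc.
by rewrite /cst -linearZ /= [_ *: _]mulr1.
Qed.

Lemma smooth_on_derive1n V D (c : R -> V) n : open D ->
  smooth_on D c -> smooth_on D (derive1n n c).
Proof.
by move=> oD Sc; elim: n => // n IH k; apply: ((Ck_curve _ _ oD).1 (IH k.+1)).2.
Qed.

Lemma derive1_near V (D : set R) (c1 c2 : R -> V) t : open D ->
  (forall t, D t -> c1 t = c2 t) -> D t -> derive1 c1 t = derive1 c2 t.
Proof.
move=> oD E Dt; rewrite !derive1E; apply: near_eq_derive; near=> s.
by apply: E; near: s; exact: open_nbhs_nbhs.
Unshelve. all: by end_near. Qed.

Lemma derive1n_near V (D : set R) (c1 c2 : R -> V) n t : open D ->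
  (forall t, D t -> c1 t = c2 t) -> D t -> derive1n n c1 t = derive1n n c2 t.
Proof.
move=> oD E; elim: n t => [|n IH] t Dt; first exact: E.
by apply: (derive1_near oD) Dt => s Ds; exact: IH.
Qed.

Lemma derive1_is_derive V (c : R -> V) (t : R) v :
  is_derive t (1 : R) c v -> derive1 c t = v.
Proof. by move=> [_ <-]; rewrite derive1E. Qed.

Lemma differentiable_is_derive V (c : R -> V) (t : R) :
  differentiable c t -> is_derive t (1 : R) c (derive1 c t).
Proof. by move=> dc; split; [exact/derivable1_diffP|rewrite derive1E]. Qed.

Definition integral_curve V (g : V -> V) (D : set R) (z : R -> V) :=
  forall t, D t -> is_derive t (1 : R) z (g (z t)).

(** Bootstrap: if [z] is of class C^k then so is [z' = g \o z]. *)
Lemma integral_curve_smooth V (g : V -> V) D z : finite_dim V -> open D ->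
  smooth g -> integral_curve g D z -> smooth_on D z.
Proof.
move=> fV oD Sg gz; have dz t : D t -> differentiable z t.
  by move=> /gz[+ _]; exact: (derivable1_diffP _ _).1.
elim=> [|k IH]; first by move=> t Dt; apply: differentiable_continuous; exact: dz.
apply/(Ck_curve _ _ oD); split=> //.
have := Ck_comp fV oD openT (Sg k) IH (fun _ _ => I).
by apply: Ck_ext => // t Dt; rewrite (derive1_is_derive (gz t Dt)).
Qed.

(** The existence theorem on rows, transported along linear coordinates
[l : V -> R^N] and [e : R^N -> V] with [e \o l = id]: if [Z] solves the equation of
the field [l \o g \o e] then [e \o Z] solves that of [g]. *)
Lemma integral_curve_exists V (g : V -> V) z0 : finite_dim V -> smooth g ->
  exists d : R, exists z : R -> V,
    [/\ 0 < d, z 0 = z0 & integral_curve g `]- d, d[ z].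
Proof.
move=> fV Sg; have [N [b [l [ll lE]]]] := fV.
pose e (Z : 'rV[R]_N) := \sum_i Z 0 i *: b i.
pose G (Z : 'rV[R]_N) : 'rV[R]_N := \row_i l i (g (e Z)).
have Se : smooth e.
  move=> k; apply: Ck_sum => [|i _]; first exact: openT.
  apply: Ck_scale; [exact: openT| |exact: Ck_cst].
  by apply: Ck_entry; [exact: openT|exact: Ck_id].
have CG : Ck_on 1 setT G.
  apply: Ck_entries => [|i j]; first exact: openT.
  rewrite (_ : (fun Z => G Z i j) = fun Z => l j ((g \o e) Z)); last first.
    by apply/funext => Z; rewrite mxE.
  apply: Ck_lin; [exact: openT|exact: (ll j).1|exact: (ll j).2|].
  by apply: smooth_comp_on => //; exact: openT.
have [d [Z [d0 Z0 dZ]]] := picard_row (\row_i l i z0) CG.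
have le : linear e.
  move=> a u v; rewrite /e scaler_sumr -big_split /=; apply: eq_bigr => i _.
  by rewrite !mxE scalerDl scalerA.
have ce : continuous e by apply: finite_dim_linear_continuous le; exact: finite_dim_mx.
exists d, (e \o Z); split=> // [|t /=].
  rewrite /= Z0 [RHS]lE; apply: eq_bigr => i _; by rewrite mxE.
rewrite in_itv /= -ltr_norml => /dZ dt.
have [de deE] := linear_diff (Z t) le ce.
have := is_derive_diff de dt; rewrite deE.
suff -> : e (G (Z t)) = g (e (Z t)) by [].
by rewrite [RHS]lE; apply: eq_bigr => i _; rewrite mxE.
Qed.

Definition lie V W (g : V -> V) (h : V -> W) : V -> W := fun z => 'd h z (g z).

Lemma smooth_lie V W (g : V -> V) (h : V -> W) n : finite_dim V ->
  smooth g -> smooth h -> smooth (iter n (lie g) h).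
Proof.
move=> fV Sg Sh; elim: n => //= n IH.
by apply: smooth_diff_apply => //; move=> k; exact: Ck_id.
Qed.

(** Time derivatives of an observable along an integral curve are functions of
the state alone, which is how the jets of solutions are seen to depend smoothly
on the initial state. *)
Lemma derive1n_integral_curve V W (g : V -> V) (h : V -> W) D z n t :
  finite_dim V -> open D -> smooth g -> smooth h -> integral_curve g D z ->
  D t -> derive1n n (h \o z) t = iter n (lie g) h (z t).
Proof.
move=> fV oD Sg Sh gz; elim: n t => // n IH t Dt.
rewrite derive1nS (derive1_near oD IH Dt); apply: derive1_is_derive.
apply: is_derive_diff; last exact: gz.
exact/smooth_differentiable/smooth_lie.
Qed.

Lemma jetE d r (c : R -> 'rV[R]_d) t i j : jet r c t i j = derive1n i c t 0 j.
Proof. by rewrite mxE. Qed.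

Lemma smooth_jet d r D (c : R -> 'rV[R]_d) : open D -> smooth_on D c ->
  smooth_on D (jet r c).
Proof.
move=> oD Sc k; apply: Ck_entries => // i j.
rewrite (_ : (fun t => jet r c t i j) = fun t => derive1n i c t 0 j); last first.
  by apply/funext => t; rewrite jetE.
by apply: Ck_entry => //; exact: smooth_on_derive1n.
Qed.

Lemma derive1_jet d r D (c : R -> 'rV[R]_d) t : open D -> smooth_on D c -> D t ->
  derive1 (jet r c) t = \matrix_(i < r.+1) derive1n i.+1 c t.
Proof.
move=> oD Sc Dt; rewrite derive1E derive_mx; last first.
  by apply/derivable1_diffP; apply: smooth_on_diff Dt; exact: smooth_jet.
apply/matrixP => i j; rewrite !mxE.
rewrite (_ : (fun t => jet r c t i j) = fun t => derive1n i c t 0 j); last first.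
  by apply/funext => s; rewrite jetE.
rewrite derive1nS derive1E derive_mx ?mxE//.
by apply/derivable1_diffP; apply: smooth_on_diff Dt; exact: smooth_on_derive1n.
Qed.

Definition jet_shift r d (Y : 'M[R]_(r.+2, d)) : 'M[R]_(r.+1, d) :=
  \matrix_(i < r.+1) row (lift ord0 i) Y.

(** The block partial derivatives assemble into a single differential, in the
direction of the shifted jet. *)
Lemma Ltau_diff m n r (phi : 'M[R]_(r.+1, m) -> 'rV[R]_n) Y : smooth phi ->
  Ltau phi Y = 'd phi (jet_trunc Y) (jet_shift Y).
Proof.
move=> Sphi.
rewrite (_ : jet_shift Y = \sum_(i < r.+1) \matrix_(k < r.+1)
    (if k == i then row (lift ord0 i) Y else 0)).
  rewrite linear_sum; apply: eq_bigr => i _.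
  by rewrite /block_partial deriveE//; exact: smooth_differentiable.
apply/matrixP => k j; rewrite summxE (bigD1 k)//= !mxE eqxx big1 ?addr0 ?mxE//.
by move=> i /negPf ik; rewrite !mxE eq_sym ik mxE.
Qed.

Lemma jet_truncE d r (c : R -> 'rV[R]_d) t : jet_trunc (jet r.+1 c t) = jet r c t.
Proof. by apply/matrixP => i j; rewrite !mxE. Qed.

(** Along a curve, [Phi] is the 1-jet of the trajectory parameterized by it. *)
Lemma Phi_jet m n r (phi : 'M[R]_(r.+1, m) -> 'rV[R]_n) D (y : R -> 'rV[R]_m) t :
  smooth phi -> open D -> smooth_on D y -> D t ->
  Phi_map phi (jet r.+1 y t) = (phi (jet r y t), derive1 (phi \o jet r y) t).
Proof.
move=> Sphi oD Sy Dt; rewrite /Phi_map jet_truncE Ltau_diff// jet_truncE.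
have dj := smooth_on_diff (smooth_jet r oD Sy) Dt.
have dphi := smooth_differentiable (jet r y t) Sphi.
have := is_derive_diff dphi (differentiable_is_derive dj).
move=> /derive1_is_derive ->; rewrite (derive1_jet _ oD)//.
by congr (_, 'd phi _ _); apply/matrixP => i j; rewrite !mxE.
Qed.

Lemma smooth_Phi m n r (phi : 'M[R]_(r.+1, m) -> 'rV[R]_n) :
  smooth phi -> smooth (Phi_map phi).
Proof.
move=> Sphi.
have Str : smooth (@jet_trunc R m r).
  move=> k; apply: Ck_entries => [|i j]; first exact: openT.
  rewrite (_ : (fun Y => jet_trunc Y i j) =
      fun Y : 'M[R]_(r.+2, m) => Y (widen_ord (leqnSn r.+1) i) j); last first.
    by apply/funext => Y; rewrite !mxE.
  by apply: Ck_entry; [exact: openT|exact: Ck_id].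
have Ssh : smooth (@jet_shift r m).
  move=> k; apply: Ck_entries => [|i j]; first exact: openT.
  rewrite (_ : (fun Y => jet_shift Y i j) =
      fun Y : 'M[R]_(r.+2, m) => Y (lift ord0 i) j); last first.
    by apply/funext => Y; rewrite !mxE.
  by apply: Ck_entry; [exact: openT|exact: Ck_id].
have fM := @finite_dim_mx R r.+1 m.
move=> k; apply: Ck_pair; first exact: openT.
  by apply: (smooth_comp_on (f := @jet_trunc R m r)) => //; exact: openT.
rewrite (_ : Ltau phi = fun Y => 'd phi (jet_trunc Y) (jet_shift Y)).
  exact: smooth_diff_apply.
by apply/funext => Y; exact: Ltau_diff.
Qed.

(** The Taylor polynomial with coefficients the rows of [Y]. Its [j]-th
derivative is [p j], the same sum with the exponents lowered by [j]. *)
Lemma exists_jet d r (Y : 'M[R]_(r.+1, d)) :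
  exists y : R -> 'rV[R]_d, smooth y /\ jet r y 0 = Y.
Proof.
pose e n (t : R) : R := t ^+ n / n`!%:R.
have de n t : is_derive t (1 : R) (e n.+1 : R -> R) (e n t).
  have h := is_deriveZ (n.+1`!%:R^-1 : R) (is_deriveX n.+1 (is_derive_id t (1 : R))).
  have -> : e n.+1 = n.+1`!%:R^-1 *: (id ^+ n.+1 : R -> R).
    by apply/funext => s; rewrite /e !fctE mulrC.
  apply: is_derive_eq h _; rewrite /e factS natrM invfM.
  rewrite -[LHS]/(n.+1%:R^-1 / n`!%:R * (n.+1%:R * t ^+ n * 1)) mulr1.
  by rewrite mulrA (mulrAC n.+1%:R^-1) mulVf ?pnatr_eq0// mul1r mulrC.
(* the guard discards the terms killed by j differentiations, for which the
   truncated exponent k - j would be meaningless *)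
pose p j t := \sum_(k < r.+1) (if (j <= k)%N then e (k - j)%N t else 0) *: row k Y.
have dp j t : is_derive t (1 : R) (p j) (p j.+1 t).
  have -> : p j = \sum_(k < r.+1)
      (fun s => (if (j <= k)%N then e (k - j)%N s else 0) *: row k Y).
    by apply/funext => s; rewrite fct_sumE.
  apply: is_derive_sum => k; apply: is_derive_scalel.
  case: ltngtP => [jk|kj|jk].
  - by rewrite -(subnSK jk); exact: de.
  - exact: is_derive_cst.
  - rewrite jk subnn (_ : e 0%N = cst 1); first exact: is_derive_cst.
    by apply/funext => s; rewrite /e expr0 fact0 divr1.
have p'E j : derive1 (p j) = p j.+1 by apply/funext => t; exact: derive1_is_derive.
have pE j : derive1n j (p 0%N) = p j by elim: j => // j IH; rewrite derive1nS IH.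
exists (p 0%N); split.
  suff Sp k j : Ck_on k setT (p j) by move=> k; exact: Sp.
  elim: k j => [|k IH] j.
    move=> t _; apply: differentiable_continuous.
    by apply/derivable1_diffP; case: (dp j t).
  apply/(Ck_curve _ _ openT); rewrite p'E; split=> // t _.
  by apply/derivable1_diffP; case: (dp j t).
apply/matrixP => i j; rewrite jetE pE /p summxE (bigD1 i)//= big1 ?addr0.
  by rewrite leqnn subnn /e expr0 fact0 divr1 scale1r mxE.
move=> k ki; case: leqP => [ik|_]; last by rewrite scale0r mxE.
rewrite /e expr0n subn_eq0 leqNgt ltn_neqAle ik andbT eq_sym.
by rewrite (inj_eq val_inj) ki /= mul0r scale0r mxE.
Qed.

End Curves.

(** * Smooth one-sided inverses of matrices *)

Section Matrices.
Variable R : realType.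
Implicit Types V W : normedModType R.

Lemma Ck_mul V k D (a b : V -> R) : open D -> Ck_on k D a -> Ck_on k D b ->
  Ck_on k D (fun x => a x * b x).
Proof. by move=> oD Ca Cb; exact: (Ck_scale (W := R^o) oD Ca Cb). Qed.

Lemma Ck_prod V k D (I : Type) (s : seq I) (a : I -> V -> R) : open D ->
  (forall i, Ck_on k D (a i)) -> Ck_on k D (fun x => \prod_(i <- s) a i x).
Proof.
move=> oD Ca; elim: s => [|i s IH].
  have -> : (fun x => \prod_(j <- [::]) a j x) = cst 1.
    by apply/funext => x; rewrite big_nil.
  exact: Ck_cst.
have -> : (fun x => \prod_(j <- i :: s) a j x) =
    fun x => a i x * \prod_(j <- s) a j x by apply/funext => x; rewrite big_cons.
exact: Ck_mul.
Qed.

Lemma Ck_det V k D n (A : V -> 'M[R]_n) : open D -> Ck_on k D A ->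
  Ck_on k D (fun x => \det (A x) : R).
Proof.
move=> oD CA; apply: (Ck_sum (W := R^o)) => // s _.
apply: Ck_mul => //; first exact: (Ck_cst (W := R^o)).
by apply: Ck_prod => // i; exact: Ck_entry.
Qed.

Lemma Ck_mulmx V k D m n p (A : V -> 'M[R]_(m, n)) (B : V -> 'M[R]_(n, p)) :
  open D -> Ck_on k D A -> Ck_on k D B -> Ck_on k D (fun x => A x *m B x).
Proof.
move=> oD CA CB; apply: Ck_entries => // i j.
have -> : (fun x => (A x *m B x) i j) = fun x => \sum_l A x i l * B x l j.
  by apply/funext => x; rewrite mxE.
apply: (Ck_sum (W := R^o)) => // l _.
by apply: Ck_mul => //; exact: Ck_entry.
Qed.

Lemma Ck_trmx V k D m n (A : V -> 'M[R]_(m, n)) : open D -> Ck_on k D A ->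
  Ck_on k D (fun x => (A x)^T).
Proof.
move=> oD CA; apply: Ck_entries => // i j.
have -> : (fun x => (A x)^T i j) = fun x => A x j i by apply/funext => x; rewrite mxE.
exact: Ck_entry.
Qed.

(** Cramer's rule: the inverse is the adjugate, polynomial in the entries,
divided by the determinant. *)
Lemma Ck_invmx V k D n (A : V -> 'M[R]_n) : open D ->
  (forall x, D x -> A x \in unitmx) -> Ck_on k D A ->
  Ck_on k D (fun x => invmx (A x)).
Proof.
move=> oD uA CA.
apply: (@Ck_ext _ _ _ _ _ (fun x => (\det (A x))^-1 *: \adj (A x))) => //.
  by move=> x Dx; rewrite /invmx uA.
apply: Ck_scale => //.
  apply: Ck_inv => [//|x Dx|]; last exact: Ck_det.
  by have := uA x Dx; rewrite unitmxE unitfE.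
apply: Ck_entries => // i j.
have -> : (fun x => (\adj (A x)) i j) = fun x => (-1) ^+ (j + i) *
    \det (row' j (col' i (A x))) by apply/funext => x; rewrite mxE.
apply: Ck_mul => //; first exact: (Ck_cst (W := R^o)).
apply: Ck_det => //; apply: Ck_entries => // a b.
have -> : (fun x => (row' j (col' i (A x))) a b) = fun x => A x (lift j a) (lift i b).
  by apply/funext => x; rewrite !mxE.
exact: Ck_entry.
Qed.

(** The Moore-Penrose inverse of a matrix of full column rank; unlike an
arbitrary left inverse it depends smoothly on the matrix. *)
Definition left_inverse n q (A : 'M[R]_(n, q)) : 'M[R]_(q, n) :=
  invmx (A^T *m A) *m A^T.

(** If [v A^T A = 0] then [|v A^T|^2 = 0], so [v A^T = 0], so [v = 0] as [A^T]
has independent rows. *)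
Lemma gram_unit n q (A : 'M[R]_(n, q)) : \rank A = q -> A^T *m A \in unitmx.
Proof.
move=> rA; rewrite -row_free_unit -kermx_eq0.
apply/eqP/row_matrixP => i; rewrite row0.
set v := row i _.
have vK : v *m (A^T *m A) = 0 by rewrite -row_mul mulmx_ker row0.
have vA0 : v *m A^T = 0.
  pose u := v *m A^T.
  have uu : \sum_j u 0 j ^+ 2 = 0.
    have : (u *m u^T) 0 0 = 0.
      by rewrite /u trmx_mul trmxK mulmxA -(mulmxA v) vK mul0mx mxE.
    rewrite mxE => h; rewrite -[RHS]h; apply: eq_bigr => j _.
    by rewrite [X in _ = _ * X]mxE expr2.
  apply/rowP => j; rewrite -/u [RHS]mxE.
  have := @psumr_eq0P _ _ xpredT (fun j => u 0 j ^+ 2) (fun j _ => sqr_ge0 _) uu j isT.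
  by move/eqP; rewrite sqrf_eq0 => /eqP.
have fA : row_free A^T by rewrite /row_free mxrank_tr rA.
by apply: (row_free_inj fA); rewrite vA0 mul0mx.
Qed.

Lemma left_inverseK n q (A : 'M[R]_(n, q)) : \rank A = q -> left_inverse A *m A = 1%:M.
Proof. by move=> rA; rewrite /left_inverse -mulmxA mulVmx ?gram_unit. Qed.

Lemma Ck_left_inverse V k D n q (A : V -> 'M[R]_(n, q)) : open D ->
  (forall x, D x -> \rank (A x) = q) -> Ck_on k D A ->
  Ck_on k D (fun x => left_inverse (A x)).
Proof.
move=> oD rA CA; have CT := Ck_trmx oD CA.
apply: Ck_mulmx => //; apply: Ck_invmx => //; last exact: Ck_mulmx.
by move=> x Dx; apply: gram_unit; exact: rA.
Qed.

End Matrices.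

(** * A field with the constraint as first integral *)

Section FirstIntegral.
Variables (R : realType) (n q : nat) (F : 'rV[R]_n * 'rV[R]_n -> 'rV[R]_q).
Hypothesis F_smooth : smooth F.
Hypothesis F_rank : forall x p : 'rV[R]_n,
  \rank ('J (fun p' : 'rV[R]_n => F (x, p')) p) = q.

Let fin_xp : finite_dim ('rV[R]_n * 'rV[R]_n)%type.
Proof. by apply: finite_dim_pair; exact: finite_dim_mx. Qed.

(** The matrix of [dF/dp] for the action on row vectors; it agrees with
the Jacobian of the partial map, but as a function of [(x, p)] it is visibly smooth. *)
Definition jacobian_p (xp : 'rV[R]_n * 'rV[R]_n) : 'M[R]_(n, q) :=
  \matrix_(i < n) 'd F xp (0, delta_mx 0 i).

Lemma mul_jacobian_p xp v : v *m jacobian_p xp = 'd F xp (0, v).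
Proof.
have -> : (0, v) = \sum_i v 0 i *: (0, delta_mx 0 i) :> 'rV[R]_n * 'rV[R]_n.
  rewrite sum_pair /=; congr (_, _); last exact: row_sum_delta.
  by rewrite big1 // => i _; rewrite scaler0.
rewrite linear_sum mulmx_sum_row; apply: eq_bigr => i _.
by rewrite linearZ rowK.
Qed.

Lemma rank_jacobian_p xp : \rank (jacobian_p xp) = q.
Proof.
case: xp => x p; rewrite -[RHS](F_rank x p); congr (\rank _).
apply/row_matrixP => i; rewrite !rowE mul_jacobian_p mul_rV_lin1.
have dF := smooth_differentiable (x, p) F_smooth.
have dc : differentiable (fun p' : 'rV[R]_n => (x, p')) p.
  by apply: differentiable_pair; [exact: differentiable_cst|].
rewrite (diff_comp dc dF) /=; congr ('d F _ _).
have := @diff_pair R _ _ _ (cst x) id p (differentiable_cst _ _) ex_diff.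
move=> ->; congr (_, _); first by rewrite (@diff_cst R _ _ x p).
by rewrite (@diff_val _ _ _ _ _ id id (is_diff_id p)).
Qed.

(** Points [((x, p), t)]: a position, a velocity and the time. *)
Definition state := (('rV[R]_n * 'rV[R]_n) * R^o)%type.

(** The equations [x' = p], [p' = w(t) - correction], [t' = 1]. The acceleration
[w(t)] is corrected by the shortest vector for which [F (x, p)] becomes a first
integral, that is [dF(x, p)(x', p') = 0]. No correction occurs along a curve
that already satisfies the constraint and has acceleration [w], so that curve
is itself a trajectory. *)
Definition constrained_field (w : R -> 'rV[R]_n) (z : state) : state :=
  let: (xp, t) := z in
  ((xp.2, w t - 'd F xp (xp.2, w t) *m left_inverse (jacobian_p xp)), 1).

Lemma constrained_field_tangent w xp t :
  'd F xp (constrained_field w (xp, t)).1 = 0.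
Proof.
set c := 'd F xp (xp.2, w t); set A := left_inverse (jacobian_p xp).
have -> : (constrained_field w (xp, t)).1 = (xp.2, w t) - (0, c *m A).
  by congr (_, _); rewrite subr0.
rewrite linearB -mul_jacobian_p -mulmxA left_inverseK ?rank_jacobian_p//.
by rewrite mulmx1 subrr.
Qed.

Let fin_state : finite_dim state.
Proof. by apply: finite_dim_pair => //; exact: finite_dim_R. Qed.

Lemma smooth_jacobian_p : smooth jacobian_p.
Proof.
move=> k; apply: Ck_entries => [|i j]; first exact: openT.
have -> : (fun xp => jacobian_p xp i j) =
    fun xp => 'd F (id xp) (cst (0, delta_mx 0 i) xp) 0 j.
  by apply/funext => xp; rewrite mxE.
apply: Ck_entry; first exact: openT.
by apply: smooth_diff_apply => // l; [exact: Ck_id|exact: Ck_cst].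
Qed.

Lemma smooth_constrained_field w : smooth w -> smooth (constrained_field w).
Proof.
move=> Sw.
have S1 : smooth (fun z : state => z.1) by apply: smooth_linear.
have S2 : smooth (fun z : state => z.2) by apply: smooth_linear.
have Sp : smooth (fun z : state => z.1.2) by apply: smooth_linear.
have Sw2 : smooth (fun z : state => w z.2).
  apply: (smooth_comp_on (f := fun z : state => z.2)) => //; last exact: openT.
  exact: finite_dim_R.
have Sdir : smooth (fun z : state => (z.1.2, w z.2)).
  by move=> k; apply: Ck_pair => //; exact: openT.
have Sq := smooth_diff_apply fin_xp F_smooth S1 Sdir.
have SA : smooth (fun z : state => left_inverse (jacobian_p z.1)).
  move=> k; apply: Ck_left_inverse => [|z _|]; [exact: openT|exact: rank_jacobian_p|].
  apply: (smooth_comp_on (f := fun z : state => z.1)) => //; first exact: openT.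
  exact: smooth_jacobian_p.
have oT : open [set: state] by exact: openT.
move=> k.
have C1 := Ck_scale oT (Ck_cst (W := R^o) k setT (-1)) (Ck_mulmx oT (Sq k) (SA k)).
have C2 := Ck_pair oT (Sp k) (Ck_add oT (Sw2 k) C1).
apply: (Ck_ext oT _ (Ck_pair oT C2 (Ck_cst (W := R^o) k setT 1))) => -[xp t] _.
by rewrite /= /cst scaleN1r.
Qed.

(** The field is tangent to the level sets of [F]; this is why its integral
curves starting on the constraint manifold project to solutions. *)
Lemma constrained_field_invariant w (d : R) (z : R -> state) : 0 < d ->
  integral_curve (constrained_field w) `]- d, d[ z -> F (z 0).1 = 0 ->
  forall t, `]- d, d[ t -> F (z t).1 = 0.
Proof.
move=> d0 wz F0.
have dH t : `]- d, d[ t -> is_derive t (1 : R) (fun s => F (z s).1) 0.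
  move=> /wz zt.
  have [dfst fstE] : differentiable fst (z t) /\ 'd fst (z t) = fst :> (state -> _).
    by apply: linear_diff => //; exact: finite_dim_linear_continuous.
  have dF := smooth_differentiable (z t).1 F_smooth.
  have := is_derive_diff dF (is_derive_diff dfst zt).
  have E := constrained_field_tangent w (z t).1 (z t).2.
  rewrite -surjective_pairing in E.
  by rewrite fstE [X in is_derive _ _ _ X]E.
have dH0 t (a b : R) : a <= t <= b -> - d < a -> b < d ->
    is_derive t (1 : R) (fun s => F (z s).1) (cst 0 t).
  by move=> /andP[? ?] ? ?; apply: dH; rewrite /= in_itv /=; lra.
move=> t /=; rewrite in_itv /= => /andP[dt td].
apply/eqP; rewrite -normr_le0.
have [t0|t0] := leP 0 t.
  have := @mean_value R q (fun s => F (z s).1) (cst 0) 0 t 0 t0.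
  rewrite mul0r F0 subr0; apply => // s st; last by rewrite normr0.
  by apply: (dH0 s 0 t) => //; lra.
have := @mean_value R q (fun s => F (z s).1) (cst 0) t 0 0 (ltW t0).
rewrite mul0r F0 sub0r normrN; apply => // s st; last by rewrite normr0.
by apply: (dH0 s t 0) => //; lra.
Qed.

(** Differentiating [F (x, x') = 0] shows that the correction vanishes when
the prescribed acceleration is that of the solution. *)
Lemma constrained_field_lift (x : R -> 'rV[R]_n) : smooth x ->
  (forall t, F (x t, derive1 x t) = 0) ->
  integral_curve (constrained_field (derive1n 2 x)) setT
    (fun t => ((x t, derive1 x t), t)).
Proof.
move=> Sx Fx t _.
have oR : open [set: R] by exact: openT.
have d1 := differentiable_is_derive (smooth_differentiable t Sx).
have Sx' := smooth_on_derive1n 1 oR Sx.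
have d2 := differentiable_is_derive (smooth_differentiable t Sx').
have d12 := is_derive_pair d1 d2.
have F0 : 'd F (x t, derive1 x t) (derive1 x t, derive1n 2 x t) = 0.
  have dF := smooth_differentiable (x t, derive1 x t) F_smooth.
  have [_ <-] := is_derive_diff dF d12.
  rewrite (_ : _ \o _ = cst 0) ?derive_cst//.
  by apply/funext => s; exact: Fx.
rewrite /constrained_field /= F0 mul0mx subr0.
exact: (is_derive_pair d12 (is_derive_id t (1 : R))).
Qed.

End FirstIntegral.

(** * The section defined by the flat output *)

Section Flat.
Variables (R : realType) (m n : nat).
Variable F : 'rV[R]_n * 'rV[R]_n -> 'rV[R]_(n - m).
Hypothesis F_smooth : smooth F.
Hypothesis F_rank : forall x p : 'rV[R]_n,
  \rank ('J (fun p' : 'rV[R]_n => F (x, p')) p) = (n - m)%N.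
Variables (r : nat) (phi : 'M[R]_(r.+1, m) -> 'rV[R]_n).
Hypothesis phi_param : parameter_function F phi.
Variables (s : nat) (psi : 'M[R]_(s.+1, n) -> 'rV[R]_m).
Hypothesis psi_smooth : smooth psi.
Hypothesis flat : forall (I : set R) (x : R -> 'rV[R]_n) (y : R -> 'rV[R]_m),
  is_solution F I x -> smooth_on I y ->
  ((forall t, I t -> x t = phi (jet r y t)) <->
   (forall t, I t -> y t = psi (jet s x t))).

Let phi_smooth : smooth phi := phi_param.1.

Let fin_state : finite_dim (state R n).
Proof.
by do !apply: finite_dim_pair; do ?exact: finite_dim_mx; exact: finite_dim_R.
Qed.

Section Output.
Variable w : R -> 'rV[R]_n.
Hypothesis w_smooth : smooth w.
Let g := constrained_field F w.
Let g_smooth : smooth g := smooth_constrained_field F_smooth F_rank w_smooth.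
Let position (z : state R n) : 'rV[R]_n := z.1.1.
Let position_smooth : smooth position.
Proof. exact: smooth_linear. Qed.

Let position_jet (z : state R n) : 'M[R]_(s.+1, n) :=
  \matrix_(i < s.+1) iter i (lie g) position z.

Let flat_output (z : state R n) : 'rV[R]_m := psi (position_jet z).

Let flat_output_smooth : smooth flat_output.
Proof.
have oT : open [set: state R n] by exact: openT.
apply: (smooth_comp_on (f := position_jet)) => //; first exact: finite_dim_mx.
move=> k; apply: Ck_entries => // i j.
have -> : (fun z => position_jet z i j) = fun z => iter i (lie g) position z 0 j.
  by apply/funext => z; rewrite mxE.
by apply: Ck_entry => //; exact: smooth_lie.
Qed.

(** The [(r+1)]-jet of the flat output at a state. It is written with iterated
Lie derivatives, hence defined and smooth at all states, including those where
[F] does not vanish. *)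
Definition flat_jet (z : state R n) : 'M[R]_(r.+2, m) :=
  \matrix_(i < r.+2) iter i (lie g) flat_output z.

Lemma smooth_flat_jet : smooth flat_jet.
Proof.
have oT : open [set: state R n] by exact: openT.
move=> k; apply: Ck_entries => // i j.
have -> : (fun z => flat_jet z i j) = fun z => iter i (lie g) flat_output z 0 j.
  by apply/funext => z; rewrite mxE.
by apply: Ck_entry => //; exact: smooth_lie.
Qed.

Let derive1_position (D : set R) z t : open D -> integral_curve g D z -> D t ->
  derive1 (fun t => (z t).1.1) t = (z t).1.2.
Proof.
move=> oD gz Dt.
have := derive1n_integral_curve 1 fin_state oD g_smooth position_smooth gz Dt.
rewrite derive1n1 => ->.
have linp : linear position by [].
have clinp := finite_dim_linear_continuous fin_state linp.
by rewrite /= /lie (linear_diff _ linp clinp).2 /position /g; case: (z t).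
Qed.

Let flat_output_curve (D : set R) z t : open D -> integral_curve g D z -> D t ->
  psi (jet s (fun t => (z t).1.1) t) = flat_output (z t).
Proof.
move=> oD gz Dt; congr psi; apply/matrixP => i j; rewrite !mxE.
by rewrite -(derive1n_integral_curve i fin_state oD g_smooth position_smooth gz Dt).
Qed.

Let jet_flat_output (D : set R) z y t : open D -> integral_curve g D z -> D t ->
  (forall t, D t -> y t = flat_output (z t)) -> jet r.+1 y t = flat_jet (z t).
Proof.
move=> oD gz Dt yE; apply/matrixP => i j; rewrite !mxE.
rewrite (derive1n_near (c2 := flat_output \o z) _ oD yE Dt).
by rewrite (derive1n_integral_curve i fin_state oD g_smooth flat_output_smooth gz Dt).
Qed.

(** [flat_jet] is a right inverse of [Phi] on the constraint manifold: the
integral curve through the state gives a solution [x] of the system, flatness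
turns [y = psi (jet x)] into [x = phi (jet y)], and the 1-jet at time [0] is read
off. *)
Lemma Phi_flat_jet xp t0 : F xp = 0 -> Phi_map phi (flat_jet (xp, t0)) = xp.
Proof.
move=> Fxp.
have [d [z [d0 z0 gz]]] := integral_curve_exists (xp, t0) fin_state g_smooth.
pose D : set R := `]- d, d[; have oD : open D by exact: interval_open.
have D0 : D 0 by rewrite /D /= in_itv /= oppr_lt0 d0.
have Sz : smooth_on D z := integral_curve_smooth fin_state oD g_smooth gz.
pose x t := (z t).1.1.
have x'E t : D t -> derive1 x t = (z t).1.2 by exact: derive1_position.
have xsol : is_solution F D x.
  split=> //; first exact: interval_is_interval.
    by apply: (smooth_comp_on (h := position)).
  move=> t Dt; rewrite x'E// /x -surjective_pairing.
  by apply: (constrained_field_invariant F_smooth F_rank d0 gz) => //; rewrite z0.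
pose y := flat_output \o z.
have Sy : smooth_on D y by apply: smooth_comp_on.
have xE : forall t, D t -> x t = phi (jet r y t).
  by apply/(flat xsol Sy) => t Dt; rewrite (flat_output_curve oD gz Dt).
rewrite -z0 -(jet_flat_output oD gz D0 (fun _ _ => erefl)) (Phi_jet _ oD Sy D0)//.
rewrite -xE// -(derive1_near oD xE D0) x'E// /x z0 /=.
by rewrite -surjective_pairing.
Qed.

(** When [w] is the acceleration of [x = phi (jet y)], the lift of [x] is an
integral curve, and the converse direction of flatness recovers [y] from it. So
this choice of [w] makes the section of [Phi] pass through a prescribed jet. *)
Lemma flat_jet_lift (y : R -> 'rV[R]_m) t :
  smooth y -> w = derive1n 2 (phi \o jet r y) ->
  flat_jet (Phi_map phi (jet r.+1 y t), t) = jet r.+1 y t.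
Proof.
move=> Sy wE; pose x := phi \o jet r y.
have oR : open [set: R] by exact: openT.
have Sx : smooth x.
  by apply: smooth_comp_on => //; [exact: finite_dim_mx|exact: smooth_jet].
have Fx := phi_param.2 y Sy.
pose z t := ((x t, derive1 x t), t) : state R n.
have gz : integral_curve g setT z.
  by rewrite /g wE; exact: constrained_field_lift.
have xsol : is_solution F setT x by split=> // t' _; exact: Fx.
have yE t' : setT t' -> y t' = flat_output (z t').
  move=> _; rewrite -(flat_output_curve oR gz I).
  by apply: (flat xsol Sy).1.
by rewrite (Phi_jet _ oR Sy I)// (jet_flat_output oR gz I yE).
Qed.

End Output.

Lemma F_Phi_map Y : F (Phi_map phi Y) = 0.
Proof.
have [y [Sy <-]] := exists_jet Y.
by rewrite (Phi_jet _ openT Sy I)//; exact: phi_param.2.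
Qed.

(** The section through [Y] gives the inclusion of tangent spaces that needs
flatness: for a curve [c] in the manifold with [c 0 = Phi Y], differentiating
[Phi (eta (c t)) = c t] at [0] exhibits [c'(0)] as [dPhi_Y (deta (c'(0)))]. *)
Lemma surjective_submersion_Phi :
  surjective_submersion_onto (system_zero_set F) (Phi_map phi).
Proof.
have SPhi := smooth_Phi phi_smooth.
split=> // [|Y]; apply/seteqP; split.
- by move=> _ [Y _ <-]; exact: F_Phi_map.
- (* any prescribed acceleration gives a section; 0 will do *)
  move=> xp Fxp; exists (flat_jet (cst 0) (xp, 0)) => //.
  by apply: Phi_flat_jet => // k; exact: Ck_cst.
- move=> _ [V _ <-]; exists 1, (fun t => Phi_map phi (Y + t *: V)).
  have fM := @finite_dim_mx R r.+2 m.
  have oI : open (`]- (1 : R), 1[ : set R) by exact: interval_open.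
  split=> //.
  + rewrite set_mem_set; apply: smooth_comp_on => //.
    by move=> k; apply: Ck_add => //; [exact: Ck_cst|];
      apply: (Ck_scale (a := id)) => //; [exact: Ck_id|exact: Ck_cst].
  + by move=> t _; exact: F_Phi_map.
  + by rewrite scale0r addr0.
  apply: derive1_is_derive.
  have := is_derive_diff (smooth_differentiable _ SPhi) (is_derive_line Y V 0).
  by rewrite scale0r addr0.
move=> v [e [c [e0 Sc Fc c0 <-]]].
have [y [Sy yY]] := exists_jet Y.
pose x := phi \o jet r y.
have oR : open [set: R] by exact: openT.
have Sx : smooth x.
  by apply: smooth_comp_on => //; [exact: finite_dim_mx|exact: smooth_jet].
pose w := derive1n 2 x.
have Sw : smooth w by exact: smooth_on_derive1n.
pose eta (xp : 'rV[R]_n * 'rV[R]_n) := flat_jet w (xp, 0).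
have etaY : eta (Phi_map phi Y) = Y by rewrite /eta -yY flat_jet_lift.
have fin_xp : finite_dim ('rV[R]_n * 'rV[R]_n)%type.
  by apply: finite_dim_pair; exact: finite_dim_mx.
have Seta : smooth eta.
  apply: smooth_comp_on; [exact: fin_state|exact: openT|exact: smooth_flat_jet|].
  move=> k; apply: Ck_pair; [exact: openT|exact: Ck_id|exact: Ck_cst].
rewrite set_mem_set in Sc.
have oI : open (`]- e, e[ : set R) by exact: interval_open.
have I0 : `]- e, e[%classic 0 by rewrite /= in_itv /= oppr_lt0 e0.
have dc := differentiable_is_derive (smooth_on_diff Sc I0).
have dec := is_derive_diff (smooth_differentiable _ Seta) dc.
exists ('d eta (c 0) (derive1 c 0)) => //.
have := is_derive_diff (smooth_differentiable _ SPhi) dec.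
move=> /derive1_is_derive; rewrite /= c0 etaY => <-.
apply: (derive1_near oI) => // t It.
by rewrite /= /eta Phi_flat_jet //; apply: Fc; rewrite inE.
Qed.

End Flat.

Theorem proposition3p1 (R : realType) (m n : nat)
  (m_gt0 : (0 < m)%N) (m_lt_n : (m < n)%N)
  (F : 'rV[R]_n * 'rV[R]_n -> 'rV[R]_(n - m))
  (F_smooth : smooth F)
  (F_rank : forall x p : 'rV[R]_n,
     \rank ('J (fun p' : 'rV[R]_n => F (x, p')) p) = (n - m)%N)
  (F_nonempty : forall x : 'rV[R]_n, exists p : 'rV[R]_n, F (x, p) = 0)
  (f : 'rV[R]_n * 'rV[R]_m -> 'rV[R]_n)
  (f_smooth : smooth f)
  (f_param : forall (x : 'rV[R]_n) (u : 'rV[R]_m), F (x, f (x, u)) = 0)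
  (f_diffeo : forall x : 'rV[R]_n,
     diffeo_onto [set p : 'rV[R]_n | F (x, p) = 0]
                 (fun u : 'rV[R]_m => f (x, u)))
  (F_flat : differentially_flat F)
  (r : nat) (phi : 'M[R]_(r.+1, m) -> 'rV[R]_n)
  (phi_assoc : associated_to_flat F phi) :
  surjective_submersion_onto (system_zero_set F) (Phi_map phi).
Proof.
have [phi_param [s [psi [psi_smooth flat]]]] := phi_assoc.
exact: (surjective_submersion_Phi F_smooth F_rank phi_param psi_smooth flat).
Qed.
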